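(* Let $R$ be a commutative ring with identity, $M$ a finitely generated faithful multiplication $R$-module and $N$ a proper submodule of $M$. The following are equivalent: (1) $N$ is a quasi $J$-submodule of $M$. (2) $M\text{-}rad(N)$ is a quasi $J$-submodule of $M$. (3) $M\text{-}rad(N)$ is a $J$-submodule of $M$. (4) $(M\text{-}rad(N):_M\langle r\rangle)=M\text{-}rad(N)$ for all $r\in R$ with $r\notin J(R)$.
   Context: All rings are commutative with identity and all modules are unital. $J(R)$ is the Jacobson radical of $R$. For a submodule $N$ of an $R$-module $M$, $(N:M)=\{r\in R: rM\subseteq N\}$, and for an ideal $I$ of $R$, $(N:_M I)=\{m\in M: Im\subseteq N\}$. $\langle r\rangle$ is the principal ideal generated by $r$. $M$ is faithful if $(0:M)=0$; $M$ is a multiplication module if every submodule of $M$ has the form $IM$ for some ideal $I$ of $R$. A proper submodule $P$ of $M$ is prime if $rm\in P$ ($r\in R$, $m\in M$) implies $m\in P$ or $r\in(P:M)$. $M\text{-}rad(N)$ is the intersection of all prime submodules of $M$ containing $N$ (an empty intersection being $M$). A proper submodule $N$ of $M$ is a $J$-submodule if whenever $r\in R$, $m\in M$ with $rm\in N$ and $r\notin (J(R)M:M)$, then $m\in N$. A proper submodule $N$ of $M$ is a quasi $J$-submodule if whenever $r\in R$, $m\in M$ with $rm\in N$ and $r\notin (J(R)M:M)$, then $m\in M\text{-}rad(N)$. *)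

(* Defs.v *)
From HB Require Import structures.
From mathcomp Require Import all_boot all_order all_algebra.
From mathcomp Require Import boolp classical_sets.

Set Implicit Arguments.
Unset Strict Implicit.
Unset Printing Implicit Defensive.

Import GRing.Theory.
Local Open Scope ring_scope.
Local Open Scope classical_set_scope.

Definition is_submodule (R : pzRingType) (M : lmodType R) (N : set M) : Prop :=
  GRing.submod_closed [in N].

Definition proper_submodule (R : pzRingType) (M : lmodType R) (N : set M) :
    Prop :=
  is_submodule N /\ N <> [set: M].

(* Ideals are the submodules of the regular module R^o. *)
Definition is_ideal (R : comPzRingType) (I : set R) : Prop :=
  is_submodule (I : set R^o).

Definition principal_ideal (R : comPzRingType) (r : R) : set R :=
  [set x | exists a : R, x = a * r].

Definition maximal_ideal (R : comPzRingType) (I : set R) : Prop :=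
  [/\ is_ideal I, I <> [set: R] &
      forall K : set R, is_ideal K -> I `<=` K -> K = I \/ K = [set: R]].

Definition jacobson_radical (R : comPzRingType) : set R :=
  \bigcap_(I in [set I : set R | maximal_ideal I]) I.
Arguments jacobson_radical R : clear implicits.

(* I M consists of the finite sums of products a *: m with a in I. *)
Definition ideal_mul (R : comPzRingType) (M : lmodType R) (I : set R) :
    set M :=
  [set x | exists (n : nat) (a : 'I_n -> R) (m : 'I_n -> M),
     (forall i, I (a i)) /\ x = \sum_(i < n) a i *: m i].
Arguments ideal_mul {R} M I.

(* (N : M) *)
Definition residual (R : comPzRingType) (M : lmodType R) (N : set M) : set R :=
  [set r | forall m : M, N (r *: m)].

(* (N :_M I) *)
Definition residual_by (R : comPzRingType) (M : lmodType R) (N : set M)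
    (I : set R) : set M :=
  [set m | forall a : R, I a -> N (a *: m)].

Definition finitely_generated (R : comPzRingType) (M : lmodType R) : Prop :=
  exists (n : nat) (g : 'I_n -> M),
    forall x : M, exists a : 'I_n -> R, x = \sum_(i < n) a i *: g i.

Definition faithful_module (R : comPzRingType) (M : lmodType R) : Prop :=
  residual [set (0 : M)] = [set (0 : R)].

Definition multiplication_module (R : comPzRingType) (M : lmodType R) : Prop :=
  forall N : set M, is_submodule N ->
    exists I : set R, is_ideal I /\ N = ideal_mul M I.

Definition prime_submodule (R : comPzRingType) (M : lmodType R) (P : set M) :
    Prop :=
  proper_submodule P /\
  forall (r : R) (m : M), P (r *: m) -> P m \/ residual P r.

(* M-rad(N); the whole of M when no prime submodule contains N. *)
Definition module_radical (R : comPzRingType) (M : lmodType R) (N : set M) :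
    set M :=
  \bigcap_(P in [set P : set M | prime_submodule P /\ N `<=` P]) P.

Definition J_submodule (R : comPzRingType) (M : lmodType R) (N : set M) :
    Prop :=
  proper_submodule N /\
  forall (r : R) (m : M), N (r *: m) ->
    ~ residual (ideal_mul M (jacobson_radical R)) r -> N m.

Definition quasi_J_submodule (R : comPzRingType) (M : lmodType R)
    (N : set M) : Prop :=
  proper_submodule N /\
  forall (r : R) (m : M), N (r *: m) ->
    ~ residual (ideal_mul M (jacobson_radical R)) r -> module_radical N m.

(* Main.v *)
(* For a finitely generated faithful module, the determinant trick shows that
   rM <= JM forces r into J, so (JM : M) = J. The key step is (1) => (2): if
   r is outside J and rm lies in rad(N), write Rm = IM; for a in I the element
   ra maps M into rad(N), and since M is finitely generated some power
   (ra)^k maps M into N. As r^k is still outside J, a^k M lies in rad(N), hence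
   so does aM, whence m is in IM <= rad(N). *)
Require Import Defs.
From HB Require Import structures.
From mathcomp Require Import all_boot all_order all_algebra.
From mathcomp Require Import boolp classical_sets.

Set Implicit Arguments.
Unset Strict Implicit.
Unset Printing Implicit Defensive.

Import GRing.Theory.
Local Open Scope ring_scope.
Local Open Scope classical_set_scope.

(** * Closure properties of submodules and ideals *)

Lemma is_submoduleP (R : pzRingType) (M : lmodType R) (N : set M) :
  is_submodule N <->
  N 0 /\ forall (a : R) u v, N u -> N v -> N (a *: u + v).
Proof.
split=> [[N0 NL]|[N0 NL]]; split.
- exact: set_mem N0.
- by move=> a u v Nu Nv; apply: set_mem; apply: NL; apply: mem_set.
- exact: mem_set.
- by move=> a u v /set_mem Nu /set_mem Nv; apply: mem_set; apply: NL.
Qed.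

Lemma submodule0 (R : pzRingType) (M : lmodType R) (N : set M) :
  is_submodule N -> N 0.
Proof. by case/is_submoduleP. Qed.

Lemma submoduleD (R : pzRingType) (M : lmodType R) (N : set M) u v :
  is_submodule N -> N u -> N v -> N (u + v).
Proof. by case/is_submoduleP=> _ NL Nu Nv; rewrite -(scale1r u); apply: NL. Qed.

Lemma submoduleZ (R : pzRingType) (M : lmodType R) (N : set M) (a : R) u :
  is_submodule N -> N u -> N (a *: u).
Proof. by case/is_submoduleP=> N0 NL Nu; rewrite -(addr0 (_ *: _)); apply: NL. Qed.

Lemma submodule_sum (R : pzRingType) (M : lmodType R) (N : set M)
    (I : Type) (s : seq I) (F : I -> M) :
  is_submodule N -> (forall i, N (F i)) -> N (\sum_(i <- s) F i).
Proof.
move=> sN NF; apply: big_ind => //; first exact: submodule0.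
by move=> x y; apply: submoduleD.
Qed.

Lemma idealD (R : comPzRingType) (I : set R) x y :
  is_ideal I -> I x -> I y -> I (x + y).
Proof. exact: (@submoduleD R R^o). Qed.

Lemma idealM (R : comPzRingType) (I : set R) a x :
  is_ideal I -> I x -> I (a * x).
Proof. exact: (@submoduleZ R R^o). Qed.

(** The determinant is a polynomial in the entries, so congruence modulo [I] passes through the sums
    and products of the Leibniz formula. *)
Lemma ideal_det (R : comPzRingType) (I : set R) n (A B : 'M[R]_n) :
  is_ideal I -> (forall i j, I (A i j - B i j)) -> I (\det A - \det B).
Proof.
move=> iI AB.
have I0 x : I (x - x) by rewrite subrr; apply: (@submodule0 R R^o).
rewrite /determinant; apply: (big_ind2 (fun x y => I (x - y))) => //.
  by move=> x1 x2 y1 y2 h1 h2; rewrite opprD addrACA; apply: idealD.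
move=> s _; rewrite -mulrBr; apply: idealM => //.
apply: (big_ind2 (fun x y => I (x - y))) => // x1 x2 y1 y2 h1 h2.
have ->: x1 * y1 - x2 * y2 = y1 * (x1 - x2) + x2 * (y1 - y2).
  by rewrite !mulrBr (mulrC y1 x1) (mulrC y1 x2) addrA subrK.
by apply: idealD => //; apply: idealM.
Qed.

(** * Powers of an element and the Jacobson radical *)

Lemma maximal_ideal_exp (R : comPzRingType) (I : set R) r k :
  maximal_ideal I -> I (r ^+ k) -> I r.
Proof.
case=> iI InT Imax Irk; apply: contrapT => nIr.
pose K : set R := [set x | exists2 i, I i & exists a, x = i + a * r].
have iK : is_ideal K.
  apply/is_submoduleP; split.
    exists 0; first exact: (@submodule0 R R^o).
    by exists 0; rewrite mul0r addr0.
  move=> a _ _ [i Ii [b ->]] [j Ij [c ->]]; exists (a * i + j).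
    by apply: idealD => //; apply: idealM.
  by exists (a * b + c); rewrite scalerDr addrACA mulrDl -mulrA.
have IK : I `<=` K by move=> x Ix; exists x => //; exists 0; rewrite mul0r addr0.
have Kr : K r.
  exists 0; first exact: (@submodule0 R R^o).
  by exists 1; rewrite mul1r add0r.
have [KI|KT] := Imax _ iK IK; first by rewrite -KI in nIr.
have [i Ii [a ia]] : K 1 by rewrite KT.
elim: k Irk => [|k IHk] Irk.
  by apply: InT; apply/seteqP; split=> // x _; rewrite -(mulr1 x); apply: idealM.
(* From [1 = i + a * r], the power [r ^+ k] is [r ^+ k * i + a * r ^+ k.+1], which lowers the
   exponent by one. *)
apply: IHk; rewrite -[r ^+ k]mulr1 ia mulrDr; apply: idealD => //.
  exact: idealM.
by rewrite mulrCA -exprSr; apply: idealM.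
Qed.

Lemma jacobson_radical_ideal (R : comPzRingType) :
  is_ideal (jacobson_radical R).
Proof.
apply/is_submoduleP; split=> [|a u v Ju Jv] I mI; have [iI _ _] := mI.
  exact: (@submodule0 R R^o).
by apply: idealD (Jv _ mI) => //; apply: idealM (Ju _ mI).
Qed.

Lemma jacobson_radical_exp (R : comPzRingType) (r : R) k :
  jacobson_radical R (r ^+ k) -> jacobson_radical R r.
Proof. by move=> Jrk I mI; apply: (maximal_ideal_exp mI (Jrk _ mI)). Qed.

(** * The determinant trick and the residual of [J M] *)

Lemma ideal_mul_generators (R : comPzRingType) (M : lmodType R) (I : set R)
    n (g : 'I_n -> M) x :
    (forall y : M, exists a : 'I_n -> R, y = \sum_(i < n) a i *: g i) ->
    is_ideal I -> ideal_mul M I x ->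
  exists a : 'I_n -> R, (forall i, I (a i)) /\ x = \sum_(i < n) a i *: g i.
Proof.
move=> gen iI [p [a [m [Ia ->]]]].
have /choice[c mc] k := gen (m k).
exists (fun i => \sum_(k < p) a k * c k i); split=> [i|].
  by apply: (@submodule_sum R R^o) => // k; rewrite mulrC; apply: idealM.
under eq_bigr do rewrite mc scaler_sumr.
rewrite exchange_big /=; apply: eq_bigr => i _; rewrite scaler_suml.
by apply: eq_bigr => k _; rewrite scalerA.
Qed.

(* Determinant trick: [\det (r - A)] annihilates the generators. *)
Lemma residual_ideal_mul_exp (R : comPzRingType) (M : lmodType R) (I : set R) r :
    finitely_generated M -> faithful_module M -> is_ideal I ->
  residual (ideal_mul M I) r -> exists k, I (r ^+ k).
Proof.
move=> [n [g gen]] faith iI rIM; exists n.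
have /choice[a /all_and2[Ia ga]] i :=
  ideal_mul_generators gen iI (rIM (g i)).
pose A : 'M[R]_n := \matrix_(i, j) a i j.
pose B := r%:M - A.
have Bg i : \sum_j B i j *: g j = 0.
  under eq_bigr do rewrite !mxE scalerBl.
  rewrite sumrB -ga (bigD1 i) //= eqxx big1 ?addr0 ?subrr // => j ji.
  by rewrite eq_sym (negPf ji) scale0r.
(* Multiplying [B g = 0] by the adjugate leaves [\det B] on the diagonal. *)
have detg k : \det B *: g k = 0.
  transitivity (\sum_j (\adj B *m B) k j *: g j).
    rewrite mul_adj_mx (bigD1 k) //= mxE eqxx big1 ?addr0 // => j jk.
    by rewrite mxE eq_sym (negPf jk) scale0r.
  under eq_bigr do rewrite mxE scaler_suml.
  rewrite exchange_big /= big1 // => i _.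
  under eq_bigr do rewrite -scalerA.
  by rewrite -scaler_sumr Bg scaler0.
have det0 : \det B = 0.
  have : residual [set (0 : M)] (\det B).
    move=> m; have [c ->] := gen m; rewrite /= scaler_sumr big1 // => i _.
    by rewrite scalerA mulrC -scalerA detg scaler0.
  by rewrite faith.
(* [r ^+ n] is the determinant of [r%:M], which agrees with [B] modulo [I] because [A] has entries
   in [I]. *)
rewrite -(det_scalar n r) -[\det _]subr0 -det0.
by apply: ideal_det => // i j; rewrite !mxE opprB addrC subrK.
Qed.

Lemma residual_jacobson (R : comPzRingType) (M : lmodType R) r :
    finitely_generated M -> faithful_module M ->
  residual (ideal_mul M (jacobson_radical R)) r -> jacobson_radical R r.
Proof.
move=> fg faith.
case/(residual_ideal_mul_exp fg faith (jacobson_radical_ideal R)) => k.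
exact: jacobson_radical_exp.
Qed.

Lemma residual_ideal_mul (R : comPzRingType) (M : lmodType R) (I : set R) r :
  I r -> residual (ideal_mul M I) r.
Proof.
by move=> Ir m; exists 1%N, (fun=> r), (fun=> m); rewrite big_ord1.
Qed.

(** * Prime submodules avoiding the powers of a scalar *)

Lemma chain_bigcup_finite (T : Type) (F : set (set T)) n (x : 'I_n -> T) :
    F !=set0 -> total_on F subset -> (forall i, (\bigcup_(X in F) X) (x i)) ->
  exists2 X, F X & forall i, X (x i).
Proof.
move=> [X0 FX0] tot; elim: n x => [|n IHn] x Fx; first by exists X0 => // -[].
have [X FX Xx] := IHn (x \o lift ord0) (fun i => Fx _).
have [Y FY Yx] := Fx ord0.
have [XY|YX] := tot _ _ FX FY.
- exists Y => // i; case: (unliftP ord0 i) => [j|] -> //.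
  by apply: XY; apply: Xx.
- exists X => // i; case: (unliftP ord0 i) => [j|] ->; last exact: YX.
  exact: Xx.
Qed.

(* A submodule maximal among those containing [N] and no [s ^+ k M] is prime;
   finite generation makes this property inductive. *)
Lemma exists_prime_submodule (R : comPzRingType) (M : lmodType R) (N : set M) s :
    finitely_generated M -> is_submodule N ->
    (forall k, ~ residual N (s ^+ k)) ->
  exists P, [/\ prime_submodule P, N `<=` P & ~ residual P s].
Proof.
move=> [n [g gen]] sN Ns.
pose good X := [/\ is_submodule X, N `<=` X & forall k, ~ residual X (s ^+ k)].
have residual_gen X r : is_submodule X -> (forall i, X (r *: g i)) ->
    residual X r.
  move=> sX Xg m; have [c ->] := gen m; rewrite scaler_sumr.
  apply: submodule_sum => // i; rewrite scalerA mulrC -scalerA.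
  exact: submoduleZ.
(* [set0] accounts for the union of the empty chain. *)
have [|P [Pgood Pmax]] :=
    @Zorn_bigcup M [set X : set M | X = set0 \/ good X].
  move=> F Fgood tot; have [F0|] := pselect ((\bigcup_(X in F) X) = set0).
    by left.
  move=> /eqP/set0P[x0 [X0 FX0 X0x0]]; right.
  have goodF X x : F X -> X x -> good X.
    by move=> FX Xx; case: (Fgood _ FX) => // X_0; rewrite X_0 in Xx.
  have [sX0 NX0 _] := goodF _ _ FX0 X0x0.
  have sU : is_submodule (\bigcup_(X in F) X).
    apply/is_submoduleP; split; first by exists X0 => //; apply: submodule0.
    move=> a u v [X FX Xu] [Y FY Yv].
    have [sX _ _] := goodF _ _ FX Xu; have [sY _ _] := goodF _ _ FY Yv.
    have [XY|YX] := tot _ _ FX FY; [exists Y|exists X] => //;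
      apply: submoduleD => //; try apply: submoduleZ => //; auto.
  split=> [//|x Nx|k Uk]; first by exists X0 => //; apply: NX0.
  have [|X FX Xg] := chain_bigcup_finite _ tot (fun i => Uk (g i)).
    by exists X0.
  have [X_0|[sX _ nX]] := Fgood _ FX; last first.
    by apply: (nX k); apply: residual_gen.
  (* The chosen member can be empty only if [n = 0]; the nonempty member [X0], which is good, then
     takes its place. *)
  have [X0X|XX0] := tot _ _ FX0 FX.
    by have := X0X _ X0x0; rewrite X_0.
  have [_ _ nX0] := goodF _ _ FX0 X0x0.
  by apply: (nX0 k); apply: residual_gen => // i; apply: XX0.
have {Pmax} Pmax Q : good Q -> P `<=` Q -> Q `<=` P.
  move=> Qgood PQ; apply: contrapT => QP.
  by apply: (Pmax Q); [split|right].
have {Pgood} [sP NP nP] : good P.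
  (* The maximal element is not [set0], since [N] itself is good and contains 0. *)
  case: Pgood => // P0; have N0 := submodule0 sN.
  have : N `<=` P by apply: Pmax; [split|rewrite P0].
  by move=> /(_ _ N0); rewrite P0.
exists P; split=> //; last by have := nP 1%N; rewrite expr1.
split; first by split=> // PT; apply: (nP 0%N) => m; rewrite PT.
move=> r m Prm; apply: contrapT => /not_orP[Pm Pr].
(* By maximality [P + L] is not good when [L] is not inside [P], so it contains some [s ^+ k M].
   This is applied to [R m] and to [r M]. *)
have absorb (L : set M) : is_submodule L -> ~ (L `<=` P) ->
    exists k, forall x, exists2 p, P p & exists2 l, L l & s ^+ k *: x = p + l.
  move=> sL LP.
  pose Q := [set x | exists2 p, P p & exists2 l, L l & x = p + l].
  have PQ : P `<=` Q.
    by move=> x Px; exists x => //; exists 0; [apply: submodule0|rewrite addr0].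
  have LQ : L `<=` Q.
    by move=> x Lx; exists 0; [apply: submodule0|exists x; rewrite ?add0r].
  have sQ : is_submodule Q.
    apply/is_submoduleP; split; first by apply: PQ; apply: submodule0.
    move=> a _ _ [p Pp [l Ll ->]] [q Pq [l' Ll' ->]].
    exists (a *: p + q); first by apply: submoduleD => //; apply: submoduleZ.
    exists (a *: l + l'); first by apply: submoduleD => //; apply: submoduleZ.
    by rewrite scalerDr addrACA.
  apply: contrapT => /forallNP nok; apply: LP.
  apply: subset_trans LQ _; apply: Pmax => //; split=> //.
  exact: subset_trans PQ.
have [||k Hk] := absorb [set x | exists a, x = a *: m].
- apply/is_submoduleP; split; first by exists 0; rewrite scale0r.
  by move=> a _ _ [b ->] [c ->]; exists (a * b + c); rewrite scalerDl scalerA.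
- by move=> LP; apply: Pm; apply: LP; exists 1; rewrite scale1r.
have [||l Hl] := absorb [set x | exists y, x = r *: y].
- apply/is_submoduleP; split; first by exists 0; rewrite scaler0.
  move=> a _ _ [b ->] [c ->]; exists (a *: b + c).
  by rewrite scalerDr !scalerA mulrC.
- by move=> LP; apply: Pr => y; apply: LP; exists y.
(* Modulo [P], [s ^+ l x] is some [r y] and [s ^+ k y] is some [a m]; hence [s ^+ (k + l) x] is
   [a (r m)], which lies in [P]. *)
apply: (nP (k + l)%N) => x; rewrite exprD -scalerA.
have [p Pp [_ [y ->] ->]] := Hl x.
rewrite scalerDr; apply: submoduleD => //; first exact: submoduleZ.
rewrite scalerA mulrC -scalerA.
have [q Pq [_ [a ->] ->]] := Hk y.
rewrite scalerDr; apply: submoduleD => //; first exact: submoduleZ.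
by rewrite scalerA mulrC -scalerA; apply: submoduleZ.
Qed.

(** * The radical of a submodule *)

Lemma module_radical_submodule (R : comPzRingType) (M : lmodType R) (N : set M) :
  is_submodule (module_radical N).
Proof.
apply/is_submoduleP; split=> [|a u v Nu Nv] P PN; have [[[sP _] _] _] := PN.
  exact: submodule0.
by apply: submoduleD (Nv _ PN) => //; apply: submoduleZ (Nu _ PN).
Qed.

Lemma sub_module_radical (R : comPzRingType) (M : lmodType R) (N : set M) :
  N `<=` module_radical N.
Proof. by move=> x Nx P [_]; apply. Qed.

Lemma module_radical_id (R : comPzRingType) (M : lmodType R) (N : set M) :
  module_radical (module_radical N) = module_radical N.
Proof.
apply/seteqP; split; last exact: sub_module_radical.
by move=> x Nx P [pP NP]; apply: Nx; split=> // y; apply.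
Qed.

(** For each prime [P] above [N], primeness strips the factors [s] off [s ^+ k] one at a time. *)
Lemma residual_module_radical_exp (R : comPzRingType) (M : lmodType R)
    (N : set M) s k :
  residual (module_radical N) (s ^+ k) -> residual (module_radical N) s.
Proof.
move=> Nsk m P PN; have [[[sP PT] pP] _] := PN.
suff /(_ m): residual P s by [].
have {Nsk} : residual P (s ^+ k) by move=> x; apply: Nsk.
elim: k => [Ps x|k IHk Psk].
  by have := Ps (s *: x); rewrite expr0 scale1r.
have [//|nPs] := pselect (residual P s); apply: IHk => x.
by have := Psk x; rewrite exprS -scalerA => /pP[].
Qed.

Lemma residual_module_radical (R : comPzRingType) (M : lmodType R)
    (N : set M) s :
    finitely_generated M -> is_submodule N ->
  residual (module_radical N) s -> exists k, residual N (s ^+ k).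
Proof.
move=> fg sN Ns; apply: contrapT => /forallNP nNs.
have [P [pP NP]] := exists_prime_submodule fg sN nNs.
by apply=> m; apply: Ns.
Qed.

Lemma module_radical_proper (R : comPzRingType) (M : lmodType R) (N : set M) :
    finitely_generated M -> proper_submodule N ->
  proper_submodule (module_radical N).
Proof.
move=> fg [sN NT]; split=> [|radT]; first exact: module_radical_submodule.
(* If the radical were [M], some power of 1 would map [M] into [N]. *)
have [|k N1] := residual_module_radical (s := 1) fg sN.
  by move=> m; rewrite radT.
apply: NT; apply/seteqP; split=> // m _.
by have := N1 m; rewrite expr1n scale1r.
Qed.

(** * The equivalences *)

Lemma quasi_J_module_radical (R : comPzRingType) (M : lmodType R) (N : set M) :
    finitely_generated M -> faithful_module M -> multiplication_module M ->
  quasi_J_submodule N -> quasi_J_submodule (module_radical N).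
Proof.
move=> fg faith mult [pN qN]; have [sN _] := pN.
split; first exact: module_radical_proper.
move=> r m Nrm nJr; rewrite module_radical_id.
have [|I [iI mI]] := mult [set x | exists a, x = a *: m].
  apply/is_submoduleP; split; first by exists 0; rewrite scale0r.
  by move=> a _ _ [b ->] [c ->]; exists (a * b + c); rewrite scalerDl scalerA.
have [p [a [x [Ia ->]]]] : ideal_mul M I m.
  by rewrite -mI; exists 1; rewrite scale1r.
apply: (submodule_sum _ (module_radical_submodule N)) => i.
have [|k Nk] := residual_module_radical (s := r * a i) fg sN.
  (* As [I M = R m], [a i y] is some [c m], so [r (a i y) = c (r m)] is in the radical. *)
  move=> y; have : ideal_mul M I (a i *: y) by apply: residual_ideal_mul.
  rewrite -mI => -[c aic]; rewrite -scalerA aic scalerA mulrC -scalerA.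
  exact: (submoduleZ _ (module_radical_submodule N)).
apply: (residual_module_radical_exp (k := k)) => y.
(* The power splits as [r ^+ k] times [a i ^+ k], and the hypothesis on [N] cancels the first
   factor. *)
apply: (qN (r ^+ k)); first by rewrite scalerA -exprMn.
move=> /(residual_jacobson fg faith) /jacobson_radical_exp Jr.
by apply: nJr; apply: residual_ideal_mul.
Qed.

Theorem theorem3 (R : comPzRingType) (M : lmodType R)
    (M_fg : finitely_generated M) (M_faithful : faithful_module M)
    (M_mult : multiplication_module M)
    (N : set M) (N_proper : proper_submodule N) :
  [<-> quasi_J_submodule N;
       quasi_J_submodule (module_radical N);
       J_submodule (module_radical N);
       forall r : R, ~ jacobson_radical R r ->
         residual_by (module_radical N) (principal_ideal r)
         = module_radical N].
Proof.
tfae.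
- exact: quasi_J_module_radical.
(* Since the radical is idempotent, the two notions coincide on [module_radical N]. *)
- by rewrite /quasi_J_submodule module_radical_id.
- move=> [_ JN] r nJr; apply/seteqP; split=> m Nm.
    apply: (JN r); first by apply: Nm; exists 1; rewrite mul1r.
    by move=> /(residual_jacobson M_fg M_faithful).
  by move=> _ [a ->]; apply: (submoduleZ _ (module_radical_submodule N)).
- move=> radN; split=> // r m Nrm nJr.
  (* [J] lies in [(J M : M)], so [r] is outside [J], and it suffices that [a (r m)] is in the
     radical for every [a]. *)
  rewrite -(radN r); last by move=> Jr; apply: nJr; apply: residual_ideal_mul.
  move=> _ [a ->]; rewrite -scalerA; apply: (submoduleZ _ (module_radical_submodule N)).
  exact: sub_module_radical.
Qed.
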